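(* Let $l\in\{0,1\}$. Suppose the randomized classifiers $\{Q_i\}$ have the form $Q_i(x)=g(x,\mathcal{D},\xi_i)$ (for all $x\in\mathcal{X}$) with $g$ deterministic and $\xi_1,\xi_2,\dots$ i.i.d. and independent of $\mathcal{D}$. Suppose also that for each $l'\in\{0,1\}$ the conditional distribution $\mathcal{L}(\theta(X)\mid\mathcal{D},Y=l')$ has a density $f_{l'}$ on $[0,1]$ that is Lipschitz in a neighborhood of $1/2$. Let $U_1,U_2,\dots$ be i.i.d. Uniform$[0,1]$ random variables independent of $\mathcal{D}$ and $(X,Y)$, and define $$Q_i^{\circ}(x):=1\{\theta(x)\ge U_i\},\qquad \bar Q_t^{\circ}(x):=\frac1t\sum_{i=1}^tQ_i^{\circ}(x),\qquad \mathrm{Err}^{\circ}_{t,l}:=\int_{\mathcal{X}}1\{|\bar Q^{\circ}_t(x)-l|\ge\tfrac12\}\,d\mu_l(x).$$ Then, as $t\to\infty$ along odd integers, $$\operatorname{var}(\mathrm{Err}^{\circ}_{t,l}\mid\mathcal{D})=\frac{1}{4t}\,\big[f_l(\tfrac12)\big]^2+o\big(\tfrac1t\big).$$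
   Context: $\mathcal{X}$ is a generic sample space; $\mathcal{D}=\{(X_j,Y_j)\}_{j=1}^n$ is a training set in $\mathcal{X}\times\{0,1\}$, which is held fixed (all expectations and variances are conditional on $\mathcal{D}$, and $o(\cdot)$ terms may depend on $\mathcal{D}$). $(X,Y)$ is a random test point in $\mathcal{X}\times\{0,1\}$, independent of $\mathcal{D}$ and of $\xi_1,\xi_2,\dots$; $\mu_l:=\mathcal{L}(X\mid Y=l)$ is the distribution of $X$ given $Y=l$. The classifiers are random functions $Q_i:\mathcal{X}\to\{0,1\}$. Define $\theta:\mathcal{X}\to[0,1]$ by $\theta(x):=\mathbb{E}[Q_1(x)\mid\mathcal{D}]$, the expectation being over $\xi_1$ with $x$ and $\mathcal{D}$ fixed. For a random variable $Z$, $\operatorname{var}(Z\mid\mathcal{D}):=\mathbb{E}[Z^2\mid\mathcal{D}]-(\mathbb{E}[Z\mid\mathcal{D}])^2$. A function $q:[0,1]\to\mathbb{R}$ is Lipschitz in a neighborhood of $1/2$ if there are constants $\kappa,\delta>0$ with $|q(s)-q(s')|\le\kappa|s-s'|$ for all $s,s'\in[1/2-\delta,1/2+\delta]$. *)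

(* Defs.v *)
From HB Require Import structures.
From mathcomp Require Export all_boot all_order all_algebra.
From mathcomp Require Export all_classical all_reals all_analysis.

Set Implicit Arguments.
Unset Strict Implicit.
Unset Printing Implicit Defensive.

Import Order.TTheory GRing.Theory Num.Theory.
Import numFieldNormedType.Exports.

Local Open Scope classical_set_scope.
Local Open Scope ring_scope.

Section Independence.
Context {R : realType} {d dE : measure_display}.
Context {Omega : measurableType d} {E : measurableType dE}.
Variable P : probability Omega R.

Definition mutually_independent (V : nat -> {RV P >-> E}) : Prop :=
  forall (s : seq nat) (A : nat -> set E),
    uniq s -> (forall i, measurable (A i)) ->
    P (\big[setI/setT]_(i <- s) (V i @^-1` A i)) =
      (\prod_(i <- s) P (V i @^-1` A i))%E.

Definition identically_distributed (V : nat -> {RV P >-> E}) : Prop :=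
  forall i (A : set E), measurable A ->
    distribution P (V i) A = distribution P (V 0%N) A.

Definition iid (V : nat -> {RV P >-> E}) : Prop :=
  mutually_independent V /\ identically_distributed V.

Definition sigma_seq (V : nat -> {RV P >-> E}) : set (set Omega) :=
  <<s \bigcup_i g_sigma_algebra_preimage (V i) >>.

Definition independent_sigma (F G : set (set Omega)) : Prop :=
  forall A B, F A -> G B -> P (A `&` B) = (P A * P B)%E.

End Independence.

Section ConditionalLaw.
Context {R : realType} {d dX : measure_display}.
Context {Omega : measurableType d} {Xs : measurableType dX}.
Variable P : probability Omega R.

Lemma measurable_label (Y : {RV P >-> bool}) (l : bool) :
  measurable (Y @^-1` [set l]).
Proof. exact: measurable_funPTI. Qed.

(* When P (Y = l) = 0, mnormalize falls back on its second argument, so the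
   value is then the unconditional law of X. *)
Definition cond_law (X : {RV P >-> Xs}) (Y : {RV P >-> bool}) (l : bool) :=
  distribution (mnormalize (mrestr P (measurable_label Y l)) P) X.

Lemma cond_lawE (X : {RV P >-> Xs}) (Y : {RV P >-> bool}) (l : bool)
    (A : set Xs) : (0 < P (Y @^-1` [set l]))%E ->
  cond_law X Y l A =
    (P (X @^-1` A `&` Y @^-1` [set l]) * (fine (P (Y @^-1` [set l])))^-1%:E)%E.
Proof.
move=> PY0.
have mY := measurable_label Y l.
have normE (mu : {measure set Omega -> \bar R}) (B : set Omega) :
    mu setT = P (Y @^-1` [set l]) ->
    mnormalize mu P B = (mu B * (fine (P (Y @^-1` [set l])))^-1%:E)%E.
  move=> muT; rewrite /mnormalize muT gt_eqF//= lt_eqF//.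
  by rewrite ltey_eq fin_num_measure.
have restrT : mrestr P mY setT = P (Y @^-1` [set l]) by rewrite /mrestr setTI.
by rewrite /cond_law /distribution /pushforward /= normE.
Qed.

End ConditionalLaw.

Section Density.
Context {R : realType}.

Definition unit_itv : set (measurableTypeR R) := `[0, 1]%classic.

Definition density01 (nu : set (measurableTypeR R) -> \bar R) (f : R -> R)
    : Prop :=
  [/\ measurable_fun unit_itv f,
      (forall s, 0 <= s <= 1 -> 0 <= f s) &
      forall A : set (measurableTypeR R), measurable A ->
        nu A = (\int[lebesgue_measure]_(s in A `&` unit_itv) (f s)%:E)%E].

(* Only the values of q on [0, 1] matter, whatever the size of delta. *)
Definition lipschitz_near_half (q : R -> R) : Prop :=
  exists kappa delta : R, [/\ 0 < kappa, 0 < delta &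
    forall s s', 0 <= s <= 1 -> 0 <= s' <= 1 ->
      2^-1 - delta <= s <= 2^-1 + delta ->
      2^-1 - delta <= s' <= 2^-1 + delta ->
      `|q s - q s'| <= kappa * `|s - s'|].

End Density.

Section Voting.
Context {R : realType} {d dX : measure_display}.
Context {Omega : measurableType d} {Xs : measurableType dX}.
Variable P : probability Omega R.

(* The label 0 (resp. 1) is encoded by false (resp. true). Sequences are
   indexed from 0, so that Q 0 and U 0 stand for the first classifier and the
   first uniform variable. *)
Definition theta (Q : nat -> Omega -> Xs -> bool) (x : Xs) : R :=
  fine 'E_P[fun w => (Q 0%N w x)%:R].

Variables (th : Xs -> R) (U : nat -> {RV P >-> (measurableTypeR R)}).

Definition Qcirc (i : nat) (w : Omega) (x : Xs) : bool := th x >= U i w.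

Definition Qbar (t : nat) (w : Omega) (x : Xs) : R :=
  t%:R^-1 * \sum_(i < t) (Qcirc i w x)%:R.

Definition Err (mu : {measure set Xs -> \bar R}) (t : nat) (l : bool)
    (w : Omega) : R :=
  (\int[mu]_x (\1_[set x' | 2^-1 <= `|Qbar t w x' - l%:R|] x))%R.

End Voting.

(* Main.v *)
Require Import Defs.
From HB Require Import structures.
From mathcomp Require Import measurable_realfun ring lra zify.

Set Implicit Arguments.
Unset Strict Implicit.
Unset Printing Implicit Defensive.

Import Order.TTheory GRing.Theory Num.Theory.
Import numFieldNormedType.Exports.

Local Open Scope classical_set_scope.
Local Open Scope ring_scope.

(** Let t = 2m + 1 and let M be the median of U_0, ..., U_2m. At a point x the
majority of the t votes 1{theta(x) >= U_i} is 1 exactly when M <= theta(x),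
so the error is a function of M alone: with F the primitive of the density
f_l, it is F(M) for l = 1 and 1 - F(M) for l = 0 ([Err_primitive]). Either way
the variance to estimate is that of F(M), a one-dimensional delta-method
problem for which explicit bounds are available.

The number of U_i below a level u is binomial, and the derivative in u of a
binomial tail telescopes to a Beta density; hence M has the law
Beta(m+1, m+1) ([distribution_order_rv]). The deviation D = M - 1/2 therefore
has exact moments: mean 0, variance 1/(4(t+2)) and fourth moment
3/(16(t+2)(t+4)) = O(1/t^2), all obtained from the recurrence for
B(m+1, m+1), because the even central powers are polynomials in x(1-x).

Put a = f_l(1/2). The Lipschitz condition near 1/2, together with the
boundedness of F away from 1/2, gives one constant C with
|F(u) - F(1/2) - a(u - 1/2)| <= C(u - 1/2)^2 for all real u
([primitive_quadratic_approx]); no truncation is then required. So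
F(M) = F(1/2) + a D + H with |H| <= C D^2, and var H <= C^2 E[D^4] = O(1/t^2)
is negligible against var(aD) ~ a^2/(4t). The cross term is controlled by
var(eta D + H) >= 0 and var(-eta D + H) >= 0, which give
2|cov(D, H)| <= eta var D + (var H)/eta for every eta > 0
([variance_perturbation]): for fixed eta the right-hand side is
eta O(1/t) + O(1/t^2), and eta is arbitrary, hence o(1/t). *)

(** * Order statistics and the binomial counting formula *)

Section OrderStatistic.
Context {R : realType}.
Implicit Types (v : nat -> R) (t k : nat) (u : R).

Definition order_stat v t k : R :=
  nth 0 (sort <=%R [seq v i | i <- iota 0 t]) k.

(** In a sorted sequence the entries at most u form an initial segment, so the
entry of rank k, counted from 0, belongs to it when its length exceeds k. *)
Lemma order_stat_le v t k u : (k < t)%N ->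
  (order_stat v t k <= u) = (k < \sum_(i < t) (v i <= u)%R)%N.
Proof.
move=> kt; rewrite /order_stat; set s := sort _ _.
have ss : sorted <=%R s by apply: sort_sorted; exact: le_total.
have szs : size s = t by rewrite size_sort size_map size_iota.
have iotaE : iota 0 t = index_iota 0 t by rewrite /index_iota subn0.
have -> : (\sum_(i < t) (v i <= u)%R)%N = count (<= u)%O s.
  by rewrite /s count_sort count_map -sumn_count/= sumnE big_map iotaE big_mkord.
apply/idP/idP => [le_u|]; last exact: nth_count_le.
rewrite ltnNge; apply/negP => cle.
suff : u < nth 0 s k by rewrite ltNge le_u.
by apply: nth_count_gt => //; rewrite cle szs.
Qed.

Lemma order_stat_le_card v t k u : (k < t)%N ->
  (order_stat v t k <= u) = (k < #|[set i : 'I_t | (v i <= u)%R]%SET|)%N.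
Proof.
move=> kt; rewrite order_stat_le// -sum1_card [in RHS]big_mkcond/=.
by congr (_ < _)%N; apply: eq_bigr => i _; rewrite inE; case: (_ <= _).
Qed.

End OrderStatistic.

Section OrderStatisticLaw.
Context {R : realType} {d : measure_display} {Omega : measurableType d}.
Variables (P : probability Omega R) (U : nat -> {RV P >-> (measurableTypeR R)}).

(** The sample is split according to the set S of indices with U_i <= u: on each
piece every variable is confined to a half-line, so that independence applies,
and the rank of u depends on the cardinality of S only. *)
Let pattern u t (S : {set 'I_t}) : set Omega :=
  [set w | [set i : 'I_t | (U i w <= u)%R]%SET = S].

(** The half-lines of a piece, extended by setT to all of nat because that is
the index type of an independent family. *)
Let box u t (S : {set 'I_t}) (i : nat) : set (measurableTypeR R) :=
  if insub i is Some j then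
    (if j \in S then `]-oo, u]%classic else `]u, +oo[%classic) else setT.

Let box_ord u t (S : {set 'I_t}) (i : 'I_t) : box u S i =
  if i \in S then `]-oo, u]%classic else `]u, +oo[%classic.
Proof. by rewrite /box valK. Qed.

Let measurable_box u t (S : {set 'I_t}) i : measurable (box u S i).
Proof. by rewrite /box; case: insub => // j; case: ifP. Qed.

Let patternE u t (S : {set 'I_t}) :
  pattern u S = \big[setI/setT]_(i <- iota 0 t) (U i @^-1` box u S i).
Proof.
rewrite -bigcap_seq; apply/seteqP; split=> w.
  move=> <- i/=; rewrite mem_iota add0n => it.
  rewrite -[i]/(nat_of_ord (Ordinal it)) box_ord inE.
  by case: ifPn => /=; rewrite in_itv/= ?andbT// -ltNge.
move=> boxw; apply/setP => i; rewrite inE.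
have : (U i @^-1` box u S i) w by apply: boxw; rewrite /= mem_iota/=.
rewrite /= box_ord; case: ifPn => _ /=; rewrite in_itv/= ?andbT//.
by rewrite ltNge => /negbTE.
Qed.

Let measurable_pattern u t (S : {set 'I_t}) : measurable (pattern u S).
Proof.
rewrite patternE; apply: bigsetI_measurable => i _.
exact: measurable_funPTI.
Qed.

Let order_stat_patterns u t k : (k < t)%N ->
  [set w | order_stat (U ^~ w) t k <= u] =
  \bigcup_(S in [set S : {set 'I_t} | (k < #|S|)%N]) pattern u S.
Proof.
move=> kt; apply/seteqP; split => w/=.
  by rewrite order_stat_le_card// => ?; exists [set i : 'I_t | (U i w <= u)%R]%SET.
by move=> [S/= kS patS]; rewrite order_stat_le_card// [X in #|pred_of_set X|]patS.
Qed.

Lemma measurable_order_stat t k : (k < t)%N ->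
  measurable_fun setT (fun w => order_stat (U ^~ w) t k).
Proof.
move=> kt; apply: (measurability (@RGenOInfty.G R)).
  exact: RGenOInfty.measurableE.
move=> _ [_ [u ->] <-]; rewrite setTI.
rewrite (_ : _ @^-1` _ = ~` [set w | order_stat (U ^~ w) t k <= u]); last first.
  apply/seteqP; split=> w/=; rewrite in_itv/= andbT ltNge.
    by move=> /negP.
  by move=> /negP.
apply: measurableC.
rewrite order_stat_patterns//; exact: fin_bigcup_measurable.
Qed.

(** Summing p^|S| (1-p)^(t-|S|) over the index sets S with more than k elements,
grouped by cardinality, gives an upper binomial tail. *)
Lemma prob_order_stat_le t k u p : mutually_independent U -> (k < t)%N ->
  (forall i, P (U i @^-1` `]-oo, u]) = p%:E) ->
  P [set w | order_stat (U ^~ w) t k <= u] =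
  (\sum_(k.+1 <= j < t.+1) 'C(t, j)%:R * (p ^+ j * (1 - p) ^+ (t - j)))%:E.
Proof.
move=> indepU kt Pu.
have Pu' i : P (U i @^-1` `]u, +oo[) = (1 - p)%:E.
  rewrite -setCitvl preimage_setC probability_setC ?Pu//.
  by have /(measurable_funPTI (U i)) :
    measurable (`]-oo, u]%classic : set (measurableTypeR R)) by [].
have Ppat (S : {set 'I_t}) :
    P (pattern u S) = (p ^+ #|S| * (1 - p) ^+ (t - #|S|))%:E.
  rewrite patternE (indepU _ _ (iota_uniq 0 t) (@measurable_box u t S)).
  have iotaE : iota 0 t = index_iota 0 t by rewrite /index_iota subn0.
  rewrite iotaE big_mkord (bigID (mem S))/=.
  rewrite (eq_bigr (fun=> p%:E)); last first.
    by move=> i iS; rewrite box_ord iS Pu.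
  rewrite [X in (_ * X)%E](eq_bigr (fun=> (1 - p)%:E)); last first.
    by move=> i /negbTE iS; rewrite box_ord iS Pu'.
  rewrite !prodEFin -EFinM !prodr_const; congr (_ * _ ^+ _)%:E.
  by rewrite -[t in (t - _)%N]card_ord -(cardC (mem S)) addKn.
rewrite order_stat_patterns// content_fin_bigcup//=; last 2 first.
- by move=> S S' _ _ [w [<- <-]].
- exact: fin_bigcup_measurable.
rewrite -(@bigfs _ _ _ _ (index_enum _))/=; [|exact: index_enum_uniq|]; last first.
  by move=> S _; rewrite mem_index_enum.
rewrite (eq_bigr _ (fun S _ => Ppat S)) sumEFin; congr EFin.
rewrite (partition_big (fun S : {set 'I_t} => inord #|S| : 'I_t.+1)
  (fun j : 'I_t.+1 => (k < j)%N))/=; last first.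
  by move=> S kS; rewrite inordK// ltnS -[leqRHS]card_ord max_card.
rewrite (@big_nat_widenl _ _ _ _ 0%N)// big_mkord/=; apply: eq_bigr => j kj.
rewrite (eq_bigr (fun=> p ^+ j * (1 - p) ^+ (t - j))); last first.
  move=> S /andP[_ /eqP <-].
  by rewrite inordK// ltnS -[leqRHS]card_ord max_card.
have -> : 'C(t, j) = #|[set S : {set 'I_t} | #|S| == j]%SET|.
  by rewrite card_draws card_ord.
rewrite mulr_natl -sumr_const; apply: eq_bigl => S.
have St : (#|S| < t.+1)%N by rewrite ltnS -[leqRHS]card_ord max_card.
rewrite inE -val_eqE/= inordK//; case: eqVneq => [->|_]; last by rewrite andbF.
by rewrite andbT.
Qed.

End OrderStatisticLaw.

(** * Binomial tails as Beta distribution functions *)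

Section BetaCdf.
Context {R : realType}.
Local Notation mu := (@lebesgue_measure R).
Implicit Types (n k : nat) (u : R).

(** The tail is kept as a polynomial, so that differentiating it is algebra. *)
Definition binomial_tail n k : {poly R} :=
  \sum_(k.+1 <= j < n.+1) 'C(n, j)%:R *: ('X^j * (1 - 'X) ^+ (n - j)).

Lemma horner_binomial_tail n k u : (binomial_tail n k).[u] =
  \sum_(k.+1 <= j < n.+1) 'C(n, j)%:R * (u ^+ j * (1 - u) ^+ (n - j)).
Proof.
rewrite /binomial_tail horner_sum; apply: eq_bigr => j _.
by rewrite !hornerE.
Qed.

Lemma binomial_tail_at0 n k : (binomial_tail n k).[0] = 0.
Proof.
rewrite horner_binomial_tail big_nat big1// => j /andP[kj _].
by rewrite expr0n gtn_eqF ?(leq_trans _ kj)// mul0r mulr0.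
Qed.

Lemma binomial_tail_at1 n k : (k < n)%N -> (binomial_tail n k).[1] = 1.
Proof.
move=> kn; rewrite horner_binomial_tail big_nat_recr//= binn subnn subrr.
rewrite expr1n mulr1 mul1r big_nat big1 ?add0r// => j /andP[_ jn].
by rewrite expr0n subn_eq0 leqNgt jn/= !mulr0.
Qed.

(** The derivative of the term of index j is the difference D(j-1) - D(j) of
two neighbouring multiples of Bernstein polynomials, so the sum telescopes to
its first entry: the last one carries C(n, n+1) = 0. *)
Lemma deriv_binomial_tail n k : (k <= n)%N ->
  (binomial_tail n.+1 k)^`() =
  (n.+1 * 'C(n, k))%:R *: ('X^k * (1 - 'X) ^+ (n - k)).
Proof.
move=> kn; pose D j : {poly R} :=
  (n.+1 * 'C(n, j))%:R *: ('X^j * (1 - 'X) ^+ (n - j)).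
rewrite /binomial_tail big_add1/= raddf_sum/=.
transitivity (\sum_(k <= j < n.+1) (D j - D j.+1)).
  apply: eq_big_nat => j /andP[_ jn].
  rewrite derivZ derivM derivXn deriv_exp derivB derivC derivX sub0r subSS/=.
  rewrite /D mul_bin_diag -[(n - j.+1)%N]/(n - j.+1)%N.
  have -> : (n.+1 * 'C(n, j.+1) = (n - j) * 'C(n.+1, j.+1))%N.
    by rewrite (mul_bin_down n.+1 j.+1).
  rewrite (mulnC j.+1) (mulnC (n - j)%N) !natrM -!scalerA !scaler_nat -mulrnBl subnS.
  by congr (_ *+ _); rewrite mulN1r mulNrn mulrN mulrnAl mulrnAr.
rewrite (eq_bigr (fun j => - D j.+1 - - D j)); last first.
  by move=> j _; rewrite opprK addrC.
rewrite (telescope_sumr (fun j => - D j)) ?leqW//.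
by rewrite opprK /D [in X in - X]bin_small// muln0 scale0r oppr0 add0r.
Qed.

Lemma invr_beta_fun n k : (k <= n)%N ->
  (beta_fun k.+1 (n - k).+1)^-1 = (n.+1 * 'C(n, k))%:R :> R.
Proof.
move=> kn; rewrite beta_fun_fact subnKC// invf_div factS -(bin_fact kn).
rewrite mulnA [in LHS]natrM mulfK//.
Qed.

Lemma beta_prob_le n k u : (k <= n)%N -> 0 <= u <= 1 ->
  beta_prob k.+1 (n - k).+1 `]-oo, u] = ((binomial_tail n.+1 k).[u])%:E.
Proof.
move=> kn /andP[u0 u1]; rewrite -integral_beta_pdf//.
have tail0 := binomial_tail_at0 n.+1 k.
transitivity (\int[mu]_(x in `[0%R, u])
    ((binomial_tail n.+1 k)^`().[x])%:E)%E.
  rewrite [LHS]integral_mkcond [RHS]integral_mkcond.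
  apply: eq_integral => x _; rewrite !patchE/= !mem_setE.
  rewrite !in_itv/=; have [xu|] := leP x u; last by rewrite andbF.
  rewrite andbT /beta_pdf patchE mem_setE in_itv/= (le_trans xu u1) andbT.
  case: ifPn => _; last by rewrite mul0r.
  rewrite invr_beta_fun// deriv_binomial_tail// /XMonemX/= !hornerE.
  by congr EFin; rewrite /= -[RHS]mulrA [LHS]mulrC.
move: u0; rewrite le_eqVlt => /predU1P[<-|u0].
  by rewrite set_itv1 integral_set1 tail0.
rewrite (continuous_FTC2 (F := horner (binomial_tail n.+1 k))) ?tail0 ?sube0//.
- by apply: continuous_subspaceT => x; exact: continuous_horner.
- split.
  + by move=> x _; have [] := is_derive_poly (binomial_tail n.+1 k) x.
  + exact/cvg_at_right_filter/continuous_horner.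
  + exact/cvg_at_left_filter/continuous_horner.
- by move=> x _; rewrite derivE.
Qed.

End BetaCdf.

(** * The law of the order statistics of a uniform sample *)

Section UniformOrderStatistic.
Context {R : realType} {d : measure_display} {Omega : measurableType d}.
Variables (P : probability Omega R) (U : nat -> {RV P >-> (measurableTypeR R)}).

Definition order_rv n (k : 'I_n.+1) (w : Omega) : measurableTypeR R :=
  order_stat (U ^~ w) n.+1 k.

Let measurable_order_rv n (k : 'I_n.+1) : measurable_fun setT (order_rv k).
Proof. exact: measurable_order_stat. Qed.

HB.instance Definition _ n (k : 'I_n.+1) :=
  isMeasurableFun.Build _ _ _ _ (order_rv k) (measurable_order_rv k).

Lemma uniform_prob_le (u : R) : 0 <= u <= 1 ->
  uniform_prob (@ltr01 R) `]-oo, u] = u%:E.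
Proof.
move=> /andP[u0 u1]; rewrite /uniform_prob integral_uniform_pdf.
have -> : `]-oo, u] `&` `[0, 1] = `[0, u]%classic.
  apply/seteqP; split => x /=; rewrite !in_itv/=.
    by move=> [-> /andP[->]].
  by move=> /andP[-> xu]; rewrite xu (le_trans xu u1).
rewrite (eq_integral (cst 1%E)); last first.
  move=> x; rewrite inE/= in_itv/= => /andP[x0 xu].
  by rewrite /uniform_pdf x0 (le_trans xu u1) subr0 invr1.
rewrite integral_cst//= mul1e lebesgue_measure_itv/= lte_fin.
by case: ltP => [_|u0']; [rewrite sube0|rewrite (@le_anti _ _ u 0) ?u0' ?u0].
Qed.

Lemma uniform_prob_le0 (u : R) : u <= 0 ->
  uniform_prob (@ltr01 R) `]-oo, u] = 0%E.
Proof.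
move=> u0; apply/eqP; rewrite eq_le measure_ge0 andbT.
rewrite -[leRHS](@uniform_prob_le 0) ?lexx ?ler01// le_measure ?inE//.
exact: subitvPr.
Qed.

Lemma le_uniform_prob1 (u : R) : 1 <= u ->
  uniform_prob (@ltr01 R) `]-oo, u] = 1%E.
Proof.
move=> u1; apply/eqP; rewrite eq_le probability_le1//=.
rewrite -[leLHS](@uniform_prob_le 1) ?lexx ?ler01// le_measure ?inE//.
exact: subitvPr.
Qed.

(** The two probabilities have the same distribution function: the binomial tail
on [0, 1], and the constants 0 and 1 outside. The open right half-lines form
a generating pi-system. *)
Lemma distribution_order_rv n (k : 'I_n.+1) :
  iid U ->
  (forall A : set (measurableTypeR R), measurable A ->
     distribution P (U 0%N) A = uniform_prob (@ltr01 R) A) ->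
  forall A : set (measurableTypeR R), measurable A ->
    distribution P (order_rv k) A = beta_prob k.+1 (n - k).+1 A.
Proof.
move=> [indepU idU] U01; have kn : (k <= n)%N by rewrite -ltnS.
have cdfE (u : R) : distribution P (order_rv k) `]-oo, u] =
    beta_prob k.+1 (n - k).+1 `]-oo, u].
  have lawU i : P (U i @^-1` `]-oo, u]) = uniform_prob (@ltr01 R) `]-oo, u].
    by rewrite -U01// -(idU i).
  have -> : distribution P (order_rv k) `]-oo, u] =
      P [set w | order_stat (U ^~ w) n.+1 k <= u].
    by congr (P _); apply/seteqP; split=> w /=; rewrite in_itv.
  have probE p : uniform_prob (@ltr01 R) `]-oo, u] = p%:E ->
      P [set w | order_stat (U ^~ w) n.+1 k <= u] =
      ((binomial_tail n.+1 k).[p])%:E.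
    move=> up; rewrite (@prob_order_stat_le _ _ _ _ _ _ _ _ p)//.
      by rewrite horner_binomial_tail.
    by move=> i; rewrite lawU.
  have [u0|/ltW u0] := leP u 0.
    rewrite (probE 0) ?uniform_prob_le0// binomial_tail_at0.
    apply/esym/eqP; rewrite eq_le measure_ge0 andbT.
    rewrite -[leRHS]/0%:E -(binomial_tail_at0 n.+1 k) -beta_prob_le ?lexx ?ler01//.
    by rewrite le_measure ?inE//; exact: subitvPr.
  have [u1|/ltW u1] := leP u 1.
    by rewrite (probE u) ?uniform_prob_le ?beta_prob_le ?u0.
  rewrite (probE 1) ?le_uniform_prob1// binomial_tail_at1//.
  apply/esym/eqP; rewrite eq_le probability_le1//=.
  rewrite -[leLHS]/1%:E -(@binomial_tail_at1 _ n.+1 k)// -beta_prob_le ?lexx ?ler01//.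
  by rewrite le_measure ?inE//; exact: subitvPr.
have ccdfE (u : R) : distribution P (order_rv k) `]u, +oo[ =
    beta_prob k.+1 (n - k).+1 `]u, +oo[.
  by rewrite -setCitvl !probability_setC//; congr (1 - _)%E; exact: cdfE.
move=> A mA.
have mE : @measurable _ (measurableTypeR R) = <<s @RGenOInfty.G R >>.
  exact: RGenOInfty.measurableE.
have := @measure_unique _ R (measurableTypeR R) _
  (fun i => `](- i%:R), +oo[%classic) mE _ _ _
  (distribution P (order_rv k)) (beta_prob k.+1 (n - k).+1).
apply => //.
- move=> _ _ [x ->] [y ->]; exists (Num.max x y).
  by apply/seteqP; split => z /=; rewrite !in_itv/= !andbT gt_max => /andP.
- by move=> i; eexists.
- rewrite -subTset => x _; exists (Num.bound `|x|) => //=.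
  rewrite in_itv/= andbT ltrNl (le_lt_trans (ler_norm _))// normrN.
  exact: archi_boundP.
- move=> _ [x ->]; exact: ccdfE.
- by move=> i; rewrite (le_lt_trans (probability_le1 _ _)) ?ltry.
Qed.

End UniformOrderStatistic.

(** * Central moments of the Beta(m+1, m+1) distribution *)

Section BetaMoments.
Context {R : realType}.
Local Notation mu := (@lebesgue_measure R).
Local Notation XMonemX := (@XMonemX R).
Implicit Types (a b : nat) (phi : R -> R).

Lemma beta_prob_setC01 a b : beta_prob a b (~` `[0, 1]) = 0%E :> \bar R.
Proof.
transitivity (1 - 1 : \bar R)%E; last by rewrite subee.
by rewrite probability_setC//; congr (1 - _)%E; exact: beta_prob01.
Qed.

(** A Beta law lives on [0, 1], so a bound there suffices, and polynomials in
x - 1/2, unbounded on the line, are covered. *)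
Lemma integrable_beta_prob a b phi : measurable_fun setT phi ->
  (forall x, 0 <= x <= 1 -> `|phi x| <= 1) ->
  (beta_prob a b).-integrable setT (EFin \o phi).
Proof.
move=> mphi phi1.
have mphiE : measurable_fun setT (EFin \o phi) by exact/measurable_EFinP.
have mN : measurable (~` `[0, 1] : set (measurableTypeR R)) by exact: measurableC.
have [_] := negligible_integrable mN measurableT mphiE (beta_prob_setC01 a b).
apply.
rewrite setDE setCK setTI; apply: measurable_bounded_integrable => //.
- by rewrite (le_lt_trans (probability_le1 _ _)) ?ltry.
- exact: measurable_funTS.
- exists 1; split => // y y1 x /=; rewrite in_itv/= => /phi1 /le_trans; apply.
  exact: ltW.
Qed.

Lemma integral_beta_prob_bounded a b phi : measurable_fun setT phi ->
  (forall x, 0 <= x <= 1 -> `|phi x| <= 1) ->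
  (\int[beta_prob a b]_x (phi x)%:E)%E =
  ((\int[mu]_(x in `[0, 1]) (phi x * XMonemX a.-1 b.-1 x)) / beta_fun a b)%:E.
Proof.
move=> mphi phi1; have iphi := integrable_beta_prob a b mphi phi1.
have mN : measurable (~` `[0, 1] : set (measurableTypeR R)) by exact: measurableC.
rewrite (negligible_integral mN measurableT iphi (beta_prob_setC01 a b)).
rewrite setDE setCK setTI.
have i01 : (beta_prob a b).-integrable `[0, 1] (EFin \o phi).
  exact: integrableS iphi.
rewrite integral_beta_prob//; last 2 first.
- exact/measurable_EFinP/measurable_funTS.
- by case/integrableP : i01.
have bnd : mu.-integrable `[0, 1] (EFin \o (fun x => phi x * XMonemX a.-1 b.-1 x)).
  apply: measurable_bounded_integrable => //.
  - by rewrite /= lebesgue_measure_itv/= lte_fin ltr01 EFinN sube0 ltry.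
  - apply: measurable_funTS; apply: measurable_funM => //.
    exact: measurable_XMonemX.
  - exists 1; split => // y y1 x /= x01; rewrite (le_trans _ (ltW y1))//.
    rewrite normrM mulr_ile1// ?phi1//.
    by rewrite ger0_norm ?XMonemX_le1 ?XMonemX_ge0.
pose c : R := (beta_fun a b)^-1.
have ibnd : mu.-integrable `[0, 1]
    (EFin \o (fun x => c * (phi x * XMonemX a.-1 b.-1 x))).
  by rewrite /= (_ : _ \o _ = fun x => c%:E * (phi x * XMonemX a.-1 b.-1 x)%:E)%E//;
    exact: integrableZl.
rewrite mulrC -RintegralZl// /Rintegral fineK ?integrable_fin_num//.
apply: eq_integral => x; rewrite inE/= => x01.
by rewrite /beta_pdf patchE mem_set//= -EFinM; congr EFin; rewrite /c; ring.
Qed.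

Lemma Rintegral_XMonemX a b :
  \int[mu]_(x in `[0, 1]) XMonemX a b x = beta_fun a.+1 b.+1.
Proof. by rewrite Rintegral_mkcond. Qed.

Lemma beta_funSS m : beta_fun m.+2 m.+2 =
  m.+1%:R / (2 * (2 * m + 3)%:R) * beta_fun m.+1 m.+1 :> R.
Proof.
rewrite !beta_fun_fact (_ : (m.+1 + m.+1).+1 = (m + m).+3)%N; last by lia.
rewrite [(m + m).+3`!]factS [(m + m).+2`!]factS [m.+1`!]factS.
have := fact_gt0 (m + m).+1; have := fact_gt0 m.
move: (m + m).+1`! m`! => F G G0 F0; rewrite !natrM.
have -> : (m + m).+3%:R = 2 * m%:R + 3 :> R.
  by rewrite -addn3 addnn -muln2 natrD natrM mulrC.
have -> : (m + m).+2%:R = 2 * (m%:R + 1) :> R.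
  by rewrite -addn2 addnn -muln2 natrD natrM; ring.
have -> : m.+1%:R = m%:R + 1 :> R by rewrite -natr1.
have -> : (2 * m + 3)%:R = 2 * m%:R + 3 :> R by rewrite natrD natrM.
have m0 : 0 <= m%:R :> R by rewrite ler0n.
have {}F0 : F%:R != 0 :> R by rewrite pnatr_eq0 -lt0n.
by field; rewrite F0/=; apply/andP; split; apply/lt0r_neq0; lra.
Qed.

Let integrableZXM c a b :
  mu.-integrable `[0, 1] (EFin \o (fun x => c * XMonemX a b x)).
Proof.
rewrite (_ : _ \o _ = fun x => c%:E * (XMonemX a b x)%:E)%E//.
by apply: integrableZl => //; exact: integrable_XMonemX.
Qed.

(** The weight is symmetric about 1/2 and x - 1/2 = (x - (1 - x))/2. *)
Lemma beta_central_moment1 m :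
  \int[mu]_(x in `[0, 1]) ((x - 2^-1) * XMonemX m m x) = 0.
Proof.
have -> : \int[mu]_(x in `[0, 1]) ((x - 2^-1) * XMonemX m m x) =
    \int[mu]_(x in `[0, 1]) (2^-1 * XMonemX m.+1 m x - 2^-1 * XMonemX m m.+1 x).
  by apply: eq_Rintegral => x _; rewrite /XMonemX /unstable.onem !exprS; field.
rewrite RintegralB ?integrableZXM//.
rewrite !RintegralZl ?integrable_XMonemX//.
by rewrite !Rintegral_XMonemX beta_fun_sym subrr.
Qed.

(** Here (x - 1/2)^2 = 1/4 - x(1 - x), and multiplying the weight by x(1 - x)
raises both Beta parameters by one. *)
Lemma beta_central_moment2 m :
  (\int[mu]_(x in `[0, 1]) ((x - 2^-1) ^+ 2 * XMonemX m m x))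
    / beta_fun m.+1 m.+1 = (4 * (2 * m + 3)%:R)^-1.
Proof.
have -> : \int[mu]_(x in `[0, 1]) ((x - 2^-1) ^+ 2 * XMonemX m m x) =
    \int[mu]_(x in `[0, 1]) (4^-1 * XMonemX m m x - 1 * XMonemX m.+1 m.+1 x).
  by apply: eq_Rintegral => x _; rewrite /XMonemX /unstable.onem !exprS; field.
rewrite RintegralB ?integrableZXM//.
rewrite !RintegralZl ?integrable_XMonemX//.
rewrite !Rintegral_XMonemX beta_funSS.
have B0 := @beta_fun_gt0 R m.+1 m.+1.
rewrite -natr1 natrD natrM; have m0 : 0 <= m%:R :> R by rewrite ler0n.
by field; rewrite gt_eqF//= gt_eqF//; lra.
Qed.

(** Same reduction with
(x - 1/2)^4 = 1/16 - x(1 - x)/2 + x^2(1 - x)^2. *)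
Lemma beta_central_moment4 m :
  (\int[mu]_(x in `[0, 1]) ((x - 2^-1) ^+ 4 * XMonemX m m x))
    / beta_fun m.+1 m.+1 = 3 / (16 * (2 * m + 3)%:R * (2 * m + 5)%:R).
Proof.
have -> : \int[mu]_(x in `[0, 1]) ((x - 2^-1) ^+ 4 * XMonemX m m x) =
    \int[mu]_(x in `[0, 1]) (16^-1 * XMonemX m m x - 2^-1 * XMonemX m.+1 m.+1 x
    + 1 * XMonemX m.+2 m.+2 x).
  by apply: eq_Rintegral => x _; rewrite /XMonemX /unstable.onem !exprS; field.
rewrite RintegralD//; last first.
  rewrite (_ : _ \o _ = (fun x : R => (16^-1 * XMonemX m m x)%:E
    - (2^-1 * XMonemX m.+1 m.+1 x)%:E)%E)//.
  by apply: integrableB => //; exact: integrableZXM.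
rewrite RintegralB ?integrableZXM//.
rewrite !RintegralZl ?integrable_XMonemX//.
rewrite !Rintegral_XMonemX !beta_funSS.
have B0 := @beta_fun_gt0 R m.+1 m.+1.
rewrite !natrD !natrM -?(natr1 m.+1) -?(natr1 m).
have m0 : 0 <= m%:R :> R by rewrite ler0n.
field; rewrite gt_eqF//= !gt_eqF//; lra.
Qed.

End BetaMoments.

(** * Moments of the sample median *)

Section MedianMoments.
Context {R : realType} {d : measure_display} {Omega : measurableType d}.
Variables (P : probability Omega R) (U : nat -> {RV P >-> (measurableTypeR R)}).
Hypothesis hU : iid U.
Hypothesis hU01 : forall A : set (measurableTypeR R), measurable A ->
  distribution P (U 0%N) A = uniform_prob (@ltr01 R) A.

Let integral_order_rv n (k : 'I_n.+1) (phi : R -> \bar R) :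
  (\int[distribution P (order_rv U k)]_x phi x =
   \int[beta_prob k.+1 (n - k).+1]_x phi x)%E.
Proof.
by apply: eq_measure_integral => A mA _; exact: distribution_order_rv.
Qed.

Lemma integrable_order_rv n (k : 'I_n.+1) (phi : R -> R) :
  measurable_fun setT phi -> (forall x, 0 <= x <= 1 -> `|phi x| <= 1) ->
  P.-integrable setT (EFin \o (phi \o order_rv U k)).
Proof.
move=> mphi phi1; apply/integrableP; split.
  apply/measurable_EFinP.
  have mM : measurable_fun setT (order_rv U k) by exact: measurable_funPT.
  exact: (measurableT_comp mphi mM).
have /integrableP[_] := integrable_beta_prob k.+1 (n - k).+1 mphi phi1.
rewrite -integral_order_rv ge0_integral_distribution//.
by apply: measurableT_comp => //; exact/measurable_EFinP.
Qed.

Lemma expectation_order_rv n (k : 'I_n.+1) (phi : R -> R) :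
  measurable_fun setT phi -> (forall x, 0 <= x <= 1 -> `|phi x| <= 1) ->
  'E_P[phi \o order_rv U k]%E =
  ((\int[@lebesgue_measure R]_(x in `[0, 1])
      (phi x * XMonemX k (n - k) x)) / beta_fun k.+1 (n - k).+1)%:E.
Proof.
move=> mphi phi1; transitivity (\int[beta_prob k.+1 (n - k).+1]_x (phi x)%:E)%E;
  last exact: integral_beta_prob_bounded.
rewrite -integral_order_rv.
rewrite unlock; apply/esym/integral_distribution.
  exact/measurable_EFinP.
exact: integrable_order_rv.
Qed.

(** Sample size 2m+1 and rank m counted from 0, both parametrised by m so that
odd sample sizes are the only ones that arise. *)
Definition median_rv m : Omega -> measurableTypeR R :=
  order_rv U (inord m : 'I_(2 * m).+1).

Definition median_dev m (w : Omega) : R := median_rv m w - 2^-1.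

Let median_idx m : (inord m : 'I_(2 * m).+1) = m :> nat.
Proof. by rewrite inordK// ltnS leq_pmull. Qed.

Let median_coidx m : (2 * m - (inord m : 'I_(2 * m).+1))%N = m.
Proof. by rewrite median_idx mul2n -addnn addnK. Qed.

Let measurable_dev_pow i : measurable_fun setT (fun x : R => (x - 2^-1) ^+ i).
Proof. by apply: measurable_funX; exact: measurable_funB. Qed.

Let dev_pow_le1 i (x : R) : 0 <= x <= 1 -> `|(x - 2^-1) ^+ i| <= 1.
Proof.
move=> /andP[x0 x1]; rewrite normrX exprn_ile1// ler_norml; lra.
Qed.

Lemma measurable_median_dev m : measurable_fun setT (median_dev m).
Proof.
apply: measurable_funB => //.
exact: (measurable_funPT (order_rv U (inord m))).
Qed.

Lemma integrable_median_dev_pow m i :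
  P.-integrable setT (EFin \o (fun w => median_dev m w ^+ i)).
Proof.
exact: (integrable_order_rv _ (measurable_dev_pow i) (@dev_pow_le1 i)).
Qed.

Let expectation_median_dev_pow m i :
  'E_P[(fun w => median_dev m w ^+ i)%R]%E = ((\int[@lebesgue_measure R]_(x in `[0, 1])
    ((x - 2^-1) ^+ i * XMonemX m m x)) / beta_fun m.+1 m.+1)%:E.
Proof.
rewrite (expectation_order_rv _ (measurable_dev_pow i) (@dev_pow_le1 i)).
by rewrite median_coidx median_idx.
Qed.

Lemma expectation_median_dev m : 'E_P[median_dev m]%E = 0%E.
Proof.
by have := expectation_median_dev_pow m 1; rewrite beta_central_moment1 mul0r.
Qed.

Lemma expectation_median_dev2 m :
  'E_P[(fun w => median_dev m w ^+ 2)%R]%E = ((4 * (2 * m + 3)%:R)^-1)%:E.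
Proof. by rewrite expectation_median_dev_pow beta_central_moment2. Qed.

Lemma expectation_median_dev4 m : 'E_P[(fun w => median_dev m w ^+ 4)%R]%E =
  (3 / (16 * (2 * m + 3)%:R * (2 * m + 5)%:R))%:E.
Proof. by rewrite expectation_median_dev_pow beta_central_moment4. Qed.

End MedianMoments.

(** * Variance of a perturbed random variable *)

Section VariancePerturbation.
Context {R : realType} {d : measure_display} {T : measurableType d}.
Variable P : probability T R.
Implicit Types (D H : T -> R).

Lemma sqr_integrable_Lfun2 D : measurable_fun setT D ->
  P.-integrable setT (EFin \o (fun w => D w ^+ 2)) -> D \in Lfun P 2%:E.
Proof.
move=> mD iD; rewrite inE/=; apply/andP; split; rewrite inE//=.
rewrite /finite_norm unlock poweR_lty//.
case/integrableP : iD => _; apply: le_lt_trans.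
rewrite le_eqVlt; apply/orP; left; apply/eqP; apply: eq_integral => w _ /=.
by rewrite powR_mulrn// normrX.
Qed.

Lemma variance_linear_comb D H (b : R) :
  D \in Lfun P 2%:E -> H \in Lfun P 2%:E ->
  fine 'V_P[(fun w => b * D w + H w)%R] =
  b ^+ 2 * fine 'V_P[D] + fine 'V_P[H] + 2 * b * fine (covariance P D H).
Proof.
move=> D2 H2.
have Pfin : P setT \is a fin_num := fin_num_measure P _ measurableT.
have D1 := Lfun_subset12 Pfin D2.
have H1 := Lfun_subset12 Pfin H2.
have DH1 := Lfun2_mul_Lfun1 D2 H2.
have bD2 : b \o* D \in Lfun P 2%:E by rewrite Lfun_scale// ler1n.
rewrite (_ : (fun w => _) = (b \o* D \+ H)%R); last first.
  by apply/funext => w /=; rewrite mulrC.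
rewrite varianceD// varianceZ// covarianceZl//.
have := variance_fin_num D2; have := variance_fin_num H2.
have := covariance_fin_num D1 H1 DH1.
case: (covariance P D H) => [z||]// _; case: 'V_P[H]%E => [y||]// _.
case: 'V_P[D]%E => [x||]// _ /=; ring.
Qed.

(** The variances of eta D + H and -eta D + H are nonnegative; divided by eta
this bounds twice the absolute covariance by eta var D + (var H)/eta. The free
parameter eta replaces the square roots of the Cauchy-Schwarz inequality. *)
Lemma variance_perturbation D H (b eta : R) :
  D \in Lfun P 2%:E -> H \in Lfun P 2%:E -> 0 < eta ->
  `|fine 'V_P[(fun w => b * D w + H w)%R] - b ^+ 2 * fine 'V_P[D]| <=
  `|b| * (eta * fine 'V_P[D] + fine 'V_P[H] / eta) + fine 'V_P[H].
Proof.
move=> D2 H2 eta0; rewrite variance_linear_comb//.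
have := fine_ge0 (variance_ge0 P (fun w => eta * D w + H w)).
have := fine_ge0 (variance_ge0 P (fun w => - eta * D w + H w)).
rewrite !variance_linear_comb//.
have := fine_ge0 (variance_ge0 P H).
move: (fine 'V_P[D]) (fine 'V_P[H]) (fine (covariance P D H)) => x y z y0 hm hp.
have zle : `|2 * z| <= eta * x + y / eta.
  rewrite -(ler_pM2l eta0) mulrDr [X in _ + X]mulrC divfK ?gt_eqF//.
  rewrite -{1}(gtr0_norm eta0) -normrM ler_norml; apply/andP; split; nra.
rewrite [X in `|X|](_ : _ = b * (2 * z) + y); last by ring.
rewrite (le_trans (ler_normD _ _))// (ger0_norm y0) lerD2r normrM.
by rewrite ler_wpM2l.
Qed.

End VariancePerturbation.

(** * Quadratic expansion of the primitive of a density *)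

Lemma unit_itvE {R : realType} (s : R) : unit_itv s = (0 <= s <= 1) :> Prop.
Proof. by rewrite /unit_itv/= in_itv. Qed.

Section Primitive.
Context {R : realType}.
Local Notation mu := (@lebesgue_measure R).
Variable q : R -> R.
Hypothesis q_ge0 : forall s, 0 <= s <= 1 -> 0 <= q s.
Hypothesis iq : mu.-integrable unit_itv (EFin \o q).

(** The interval is open at u, so that the event theta(x) < u has probability
exactly primitive u, with no endpoint to discard. *)
Definition primitive (u : R) : R :=
  \int[mu]_(s in `]-oo, u[ `&` unit_itv) q s.

Lemma measurable_unit_itv : measurable (@unit_itv R).
Proof. exact: measurable_itv. Qed.

#[local] Hint Resolve measurable_unit_itv : core.

Lemma measurable_below (u : R) :
  measurable (`]-oo, u[ `&` unit_itv : set (measurableTypeR R)).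
Proof. by apply: measurableI => //; exact: measurable_unit_itv. Qed.

Lemma integrable_below (u : R) :
  mu.-integrable (`]-oo, u[ `&` unit_itv) (EFin \o q).
Proof. by apply: integrableS iq => //; exact: measurable_below. Qed.

Let mass := \int[mu]_(s in unit_itv) q s.

Let integral_le_mass (A : set (measurableTypeR R)) : measurable A ->
  A `<=` unit_itv -> 0 <= \int[mu]_(s in A) q s <= mass.
Proof.
move=> mA AI; rewrite Rintegral_ge0/=; last by move=> s /AI; rewrite unit_itvE => /q_ge0.
have iA : mu.-integrable A (EFin \o q) by exact: integrableS iq.
rewrite /mass /Rintegral fine_le ?integrable_fin_num//.
apply: ge0_subset_integral => //.
by case/integrableP : iq.
Qed.

Lemma primitiveB (x y : R) : 0 <= x -> x <= y -> y <= 1 ->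
  primitive y - primitive x = \int[mu]_(s in `[x, y[) q s.
Proof.
move=> x0 xy y1; rewrite /primitive.
have -> : `]-oo, y[ `&` unit_itv = (`]-oo, x[ `&` unit_itv) `|` `[x, y[ :> set R.
  apply/seteqP; split => s /=; rewrite !in_itv/= !unit_itvE.
    by move=> [sy s01]; have [xs|sx] := leP x s; [right; rewrite sy|left].
  move=> [[sx s01]|/andP[xs sy]]; first by rewrite (lt_le_trans sx xy).
  by rewrite sy (le_trans x0 xs) (le_trans (ltW sy) y1).
rewrite Rintegral_setU//.
- by rewrite addrC addKr.
- exact: measurable_below.
- apply: integrableS iq => //; first by apply: measurableU => //; exact: measurable_below.
  move=> s /= [[_ //]|]; rewrite in_itv/= unit_itvE => /andP[xs sy].
  by rewrite (le_trans x0 xs) (le_trans (ltW sy) y1).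
- apply/disj_setPS => s /= [[sx _]]; rewrite in_itv/= => /andP[xs _].
  by move: sx; rewrite in_itv/= ltNge xs.
Qed.

Lemma primitive_nondecreasing : nondecreasing_fun primitive.
Proof.
move=> x y xy; rewrite /primitive /Rintegral.
have mb := measurable_below.
rewrite fine_le ?(integrable_fin_num (mb _) (integrable_below _))//.
apply: ge0_subset_integral => //.
- by move/integrableP : (integrable_below y) => [].
- by move=> s [_]; rewrite unit_itvE lee_fin => /q_ge0.
- by move=> s /= [sx ?]; split => //; move: sx; rewrite !in_itv/= => /lt_le_trans; apply.
Qed.

Let primitive_linear_approx (x y a e : R) : 0 <= x -> x <= y -> y <= 1 ->
  (forall s, x <= s < y -> `|q s - a| <= e) ->
  `|primitive y - primitive x - a * (y - x)| <= e * (y - x).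
Proof.
move=> x0 xy y1 qe; rewrite primitiveB//.
have len : fine (mu `[x, y[) = y - x.
  rewrite lebesgue_measure_itv/= lte_fin; case: ltP => // yx.
  by rewrite (@le_anti _ _ x y) ?xy// subrr.
have icst c : mu.-integrable `[x, y[ (EFin \o cst c).
  apply: measurable_bounded_integrable => //.
    by rewrite /= lebesgue_measure_itv/=; case: ifP => _; rewrite -?EFinB ltry.
  by exists `|c|; split => // z /ltW cz s _.
have ixy : mu.-integrable `[x, y[ (EFin \o q).
  apply: integrableS iq => // s /=; rewrite in_itv/= unit_itvE => /andP[xs sy].
  by rewrite (le_trans x0 xs) (le_trans (ltW sy) y1).
rewrite -len -!Rintegral_cst// -RintegralB//; last exact: (icst a).
have iqa : mu.-integrable `[x, y[ (EFin \o (fun s => q s - a)).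
  rewrite (_ : _ \o _ = (fun s : R => (q s)%:E - (cst a s)%:E)%E)//.
  by apply: integrableB => //; exact: (icst a).
rewrite (le_trans (le_normr_Rintegral _ iqa))// le_Rintegral//.
- exact: integrable_norm.
- exact: (icst e).
Qed.

(** Within distance r of 1/2 the Lipschitz condition bounds the integrand
q - q(1/2) by kappa times the distance. Farther away the two terms are at most
the total mass and q(1/2)|u - 1/2|, and both are dominated by multiples of
(u - 1/2)^2 because |u - 1/2| > r. *)
Lemma primitive_quadratic_approx : lipschitz_near_half q ->
  exists C : R, forall u,
    `|primitive u - primitive 2^-1 - q 2^-1 * (u - 2^-1)| <= C * (u - 2^-1) ^+ 2.
Proof.
move=> [kappa [delta [kappa0 delta0 lipq]]].
(* r <= 1/2 keeps the interval of radius r around 1/2 inside [0, 1]. *)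
pose r := Num.min delta 2^-1.
have r0 : 0 < r by rewrite lt_min delta0 invr_gt0 ltr0n.
have rdelta : r <= delta by rewrite ge_min lexx.
have r2 : r <= 2^-1 by rewrite ge_min lexx orbT.
have a0 : 0 <= q 2^-1 by apply: q_ge0; lra.
have mass0 : 0 <= mass.
  by have /andP[h1 h2] := integral_le_mass measurable_unit_itv (@subset_refl _ unit_itv).
exists (kappa + mass / r ^+ 2 + q 2^-1 / r) => u.
have [ur|ru] := leP `|u - 2^-1| r.
  apply: (@le_trans _ _ (kappa * (u - 2^-1) ^+ 2)); last first.
    rewrite ler_wpM2r ?sqr_ge0// -addrA lerDl addr_ge0// divr_ge0//.
      by rewrite exprn_ge0// ltW.
    exact: ltW.
  move: ur; rewrite ler_norml => /andP[ur1 ur2].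
  have [u2|u2] := leP 2^-1 u.
    have := @primitive_linear_approx 2^-1 u (q 2^-1) (kappa * (u - 2^-1)).
    rewrite -mulrA -expr2; apply => //; [lra|].
    move=> s /andP[s1 s2].
    apply: le_trans (lipq _ _ _ _ _ _) _; try (apply/andP; split; lra).
    by apply: (ler_wpM2l (ltW kappa0)); rewrite ger0_norm; lra.
  have := @primitive_linear_approx u 2^-1 (q 2^-1) (kappa * (2^-1 - u)).
  rewrite -mulrA -expr2 -(opprB u) sqrrN.
  rewrite (_ : primitive 2^-1 - primitive u - _ =
    - (primitive u - primitive 2^-1 - q 2^-1 * (u - 2^-1))) ?normrN; last ring.
  apply => //; [lra|exact: ltW|lra|].
  move=> s /andP[s1 s2].
  apply: le_trans (lipq _ _ _ _ _ _) _; try (apply/andP; split; lra).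
  by apply: (ler_wpM2l (ltW kappa0)); rewrite ler0_norm; lra.
set D := `|u - 2^-1| in ru.
have -> : (u - 2^-1) ^+ 2 = D ^+ 2 by rewrite /D real_normK ?num_real.
have D1 : 1 <= D / r by rewrite ler_pdivlMr// mul1r ltW.
have /andP[p0 p1] := integral_le_mass (measurable_below u) (@subIsetr _ _ _).
have /andP[h0 h1] := integral_le_mass (measurable_below 2^-1) (@subIsetr _ _ _).
apply: (@le_trans _ _ (mass + q 2^-1 * D)).
  rewrite (le_trans (ler_normB _ _))// normrM (ger0_norm a0) lerD2r.
  by rewrite ler_norml /primitive; apply/andP; split; lra.
rewrite !mulrDl -addrA; apply: ler_wpDl.
  by rewrite mulr_ge0 ?sqr_ge0// ltW.
apply: lerD.
  rewrite -mulrA ler_peMr// mulrC -expr_div_n; exact: exprn_ege1.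
rewrite -mulrA ler_wpM2l// expr2 mulrA ler_peMl//; last by rewrite mulrC.
by rewrite normr_ge0.
Qed.

End Primitive.

(** * The majority error as a function of the median *)

Section ErrorAtMedian.
Context {R : realType} {d dX : measure_display}.
Context {Omega : measurableType d} {Xs : measurableType dX}.
Variables (P : probability Omega R) (U : nat -> {RV P >-> (measurableTypeR R)}).

(** theta is a partial integral of a jointly measurable nonnegative function. *)
Lemma measurable_theta {dE} {E : measurableType dE} (xi : {RV P >-> E})
    (h : Xs -> E -> bool) (Q : nat -> Omega -> Xs -> bool) :
  measurable_fun setT (fun p : Xs * E => h p.1 p.2) ->
  (forall w x, Q 0%N w x = h x (xi w)) ->
  measurable_fun setT (theta P Q).
Proof.
move=> mh Qh.
pose F (p : Xs * Omega) : \bar R := ((h p.1 (xi p.2))%:R)%:E.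
have mF : measurable_fun setT F.
  apply/measurable_EFinP.
  have mb : measurable_fun setT (fun b : bool => b%:R : R) by [].
  apply: (measurableT_comp mb).
  apply: (measurableT_comp mh (g := fun p : Xs * Omega => (p.1, xi p.2))).
  apply: measurable_fun_pair; first exact: measurable_fst.
  exact: (measurableT_comp (measurable_funPT xi) measurable_snd).
have F0 p : (0 <= F p)%E by rewrite lee_fin.
have mI := measurable_fun_fubini_tonelli_F (m2 := P) F mF F0.
have := measurableT_comp (fine_measurable measurableT) mI.
apply: eq_measurable_fun => x _.
rewrite /theta unlock /= /fubini_F; congr fine; apply: eq_integral => w _.
by rewrite Qh.
Qed.

Variables (th : Xs -> R) (mu : probability Xs R) (q : R -> R).
Hypothesis mth : measurable_fun setT th.
Hypothesis dq : density01 (pushforward mu th) q.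

Lemma median_rv_le m w (u : R) : (median_rv U m w <= u) =
  (m < \sum_(i < (2 * m).+1) (U i w <= u)%R)%N.
Proof.
rewrite /median_rv /order_rv order_stat_le ?ltn_ord//.
by rewrite inordK// ltnS leq_pmull.
Qed.

(** With c of the 2m+1 votes equal to 1, the vote is 1 when c > m; an odd number
of votes leaves no tie, so the two comparisons with 1/2 are complementary. *)
Lemma vote_error_median m w x (l : bool) :
  (2^-1 <= `|Qbar th U (2 * m).+1 w x - l%:R|) =
  (if l then th x < median_rv U m w else median_rv U m w <= th x).
Proof.
rewrite ltNge median_rv_le /Qbar /Qcirc -natr_sum.
set t := (2 * m).+1; set c := (\sum_(i < t) _)%N.
have ct : (c <= t)%N.
  rewrite -[leqRHS](card_ord t) -sum1_card; apply: leq_sum => i _; exact: leq_b1.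
have t0 : 0 < t%:R :> R by rewrite ltr0n.
have Et : t%:R = 2 * m%:R + 1 :> R by rewrite /t -natr1 natrM.
case: l.
  rewrite distrC ger0_norm; last by rewrite subr_ge0 ler_pdivrMl// mulr1 ler_nat.
  rewrite -(ler_pM2l t0) mulrBr mulr1 mulVKf ?gt_eqF//.
  rewrite -leqNgt; case: (leqP c m) => [|mc]; first by rewrite -(ler_nat R); lra.
  by apply/negbTE; rewrite -ltNge; move: mc; rewrite -(ler_nat R) -natr1; lra.
rewrite subr0 ger0_norm ?mulr_ge0 ?invr_ge0 ?ler0n//.
rewrite -(ler_pM2l t0) mulVKf ?gt_eqF//.
case: (leqP c m) => [|mc]; last by move: mc; rewrite -(ler_nat R) -natr1; lra.
by rewrite -(ler_nat R) => cm; apply/negbTE; rewrite -ltNge; lra.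
Qed.

Lemma integrable_density : (@lebesgue_measure R).-integrable unit_itv (EFin \o q).
Proof.
case: dq => mq q0 nuE; apply/integrableP; split; first exact/measurable_EFinP.
have := nuE setT measurableT; rewrite setTI => massE.
apply: (@le_lt_trans _ _ (\int[lebesgue_measure]_(s in unit_itv) (q s)%:E)%E).
  rewrite le_eqVlt; apply/orP; left; apply/eqP; apply: eq_integral => s.
  by rewrite inE unit_itvE => s01; rewrite /= ger0_norm ?q0.
by rewrite -massE /pushforward preimage_setT probability_setT ltry.
Qed.

Lemma prob_lt_primitive (u : R) : mu [set x | th x < u] = (primitive q u)%:E.
Proof.
case: dq => mq q0 nuE; have iq := integrable_density.
have -> : [set x | th x < u] = th @^-1` `]-oo, u[.
  by apply/seteqP; split => x /=; rewrite in_itv.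
rewrite -[LHS]/(pushforward mu th _) nuE// /primitive /Rintegral fineK//.
exact: (integrable_fin_num (measurable_below u) (integrable_below iq u)).
Qed.

Lemma Err_primitive m w (l : bool) : Err th U mu (2 * m).+1 l w =
  if l then primitive q (median_rv U m w) else 1 - primitive q (median_rv U m w).
Proof.
rewrite /Err.
have mlt (u : R) : measurable [set x | th x < u].
  have -> : [set x | th x < u] = th @^-1` `]-oo, u[.
    by apply/seteqP; split => x /=; rewrite in_itv.
  by rewrite -[X in measurable X]setTI; exact: mth.
have -> : [set x' | 2^-1 <= `|Qbar th U (2 * m).+1 w x' - l%:R| ] =
    if l then [set x | th x < median_rv U m w]
    else ~` [set x | th x < median_rv U m w].
  apply/seteqP; split => x /=; rewrite vote_error_median; case: l => //=.
    by rewrite leNgt => /negP.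
  by rewrite leNgt => /negP.
rewrite /Rintegral integral_indic//; last by case: l => //; exact: measurableC.
rewrite setIT; case: l; first exact: (congr1 fine (prob_lt_primitive _)).
have muC := probability_setC mu (mlt (median_rv U m w)).
by have := congr1 fine muC; rewrite prob_lt_primitive.
Qed.

End ErrorAtMedian.

(** * Variance of a function of the median *)

(** Here t is the sample size, y the variance of the remainder and v the
variance to estimate; replacing t+2 by t in the leading term costs O(1/t^2). *)
Lemma perturbation_rate {R : realType} (t y v a C eta : R) :
  0 < t -> 0 < eta -> y <= C ^+ 2 * (3 / (16 * (t + 2) * (t + 4))) ->
  `|v - a ^+ 2 * (4 * (t + 2))^-1| <=
    `|a| * (eta * (4 * (t + 2))^-1 + y / eta) + y ->
  `|v - a ^+ 2 / (4 * t)| <=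
    `|a| * eta / t + (`|a| * C ^+ 2 / eta + C ^+ 2 + a ^+ 2) / t ^+ 2.
Proof.
move=> t0 eta0 yle vle.
have t20 : 0 < t + 2 by rewrite addr_gt0.
have t40 : 0 < t + 4 by rewrite addr_gt0.
have {}yle : y <= C ^+ 2 / t ^+ 2.
  apply: le_trans yle _; apply: ler_wpM2l; first exact: sqr_ge0.
  rewrite -[leRHS]mul1r ler_pdivrMr ?mulr_gt0// mulrAC ler_pdivlMr ?exprn_gt0//.
  nra.
have varD : (4 * (t + 2))^-1 <= t^-1.
  by rewrite lef_pV2 ?posrE ?mulr_gt0//; lra.
have varD_diff : `|a ^+ 2 / (4 * (t + 2)) - a ^+ 2 / (4 * t)| <= a ^+ 2 / t ^+ 2.
  rewrite -mulrBr normrM ger0_norm ?sqr_ge0//; apply: ler_wpM2l; first exact: sqr_ge0.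
  have -> : (4 * (t + 2))^-1 - (4 * t)^-1 = - (2 * t * (t + 2))^-1.
    by field; rewrite !gt_eqF.
  rewrite normrN ger0_norm ?invr_ge0 ?mulr_ge0 ?(ltW t0) ?(ltW t20)//.
  by rewrite lef_pV2 ?posrE ?mulr_gt0 ?exprn_gt0//; nra.
have -> : v - a ^+ 2 / (4 * t) = (v - a ^+ 2 / (4 * (t + 2)))
    + (a ^+ 2 / (4 * (t + 2)) - a ^+ 2 / (4 * t)) by ring.
rewrite (le_trans (ler_normD _ _))// (le_trans (lerD vle varD_diff))//.
have -> : `|a| * eta / t + (`|a| * C ^+ 2 / eta + C ^+ 2 + a ^+ 2) / t ^+ 2 =
  `|a| * (eta * t^-1 + C ^+ 2 / t ^+ 2 / eta) + C ^+ 2 / t ^+ 2 + a ^+ 2 / t ^+ 2.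
  by field; rewrite !gt_eqF.
rewrite lerD2r lerD// ler_wpM2l// lerD//.
  by rewrite ler_wpM2l// ltW.
by rewrite ler_wpM2r// invr_ge0 ltW.
Qed.

Section MedianFunctionVariance.
Context {R : realType} {d : measure_display} {Omega : measurableType d}.
Variables (P : probability Omega R) (U : nat -> {RV P >-> (measurableTypeR R)}).
Hypothesis hU : iid U.
Hypothesis hU01 : forall A : set (measurableTypeR R), measurable A ->
  distribution P (U 0%N) A = uniform_prob (@ltr01 R) A.
Variables (F : R -> R) (a C : R).
Hypothesis mF : measurable_fun setT F.
Hypothesis approxF : forall u,
  `|F u - F 2^-1 - a * (u - 2^-1)| <= C * (u - 2^-1) ^+ 2.

Local Notation D := (median_dev U).
(** The remainder of the linear expansion of F at 1/2, taken at the median. *)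
Let H m w := F (median_rv U m w) - F 2^-1 - a * D m w.

Let D_Lfun2 m : D m \in Lfun P 2%:E.
Proof.
apply: sqr_integrable_Lfun2; first exact: measurable_median_dev.
exact: integrable_median_dev_pow.
Qed.

Let measurable_H m : measurable_fun setT (H m).
Proof.
have mM : measurable_fun setT (median_rv U m).
  exact: (measurable_funPT (order_rv U (inord m))).
apply: measurable_funB; last first.
  by apply: measurable_funM => //; exact: measurable_median_dev.
by apply: measurable_funB => //; exact: (measurableT_comp mF mM).
Qed.

Let sqr_H_le m w : H m w ^+ 2 <= C ^+ 2 * D m w ^+ 4.
Proof.
have hC := approxF (median_rv U m w).
rewrite -[H m w ^+ 2]real_normK ?num_real// (exprM _ 2 2) -exprMn.
by rewrite lerXn2r// ?nnegrE// (le_trans _ hC).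
Qed.

Let integrable_CD4 m :
  P.-integrable setT (EFin \o (fun w => C ^+ 2 * D m w ^+ 4)).
Proof.
rewrite (_ : _ \o _ = fun w => (C ^+ 2)%:E * (D m w ^+ 4)%:E)%E//.
by apply: integrableZl => //; exact: integrable_median_dev_pow.
Qed.

Let integrable_H2 m : P.-integrable setT (EFin \o (fun w => H m w ^+ 2)).
Proof.
apply: le_integrable (integrable_CD4 m) => //.
  by apply/measurable_EFinP; apply: measurable_funX; exact: measurable_H.
move=> w _ /=; rewrite lee_fin ger0_norm ?sqr_ge0//.
by rewrite (le_trans (sqr_H_le m w))// ler_norm.
Qed.

Let H_Lfun2 m : H m \in Lfun P 2%:E.
Proof.
by apply: sqr_integrable_Lfun2; [exact: measurable_H|exact: integrable_H2].
Qed.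

Lemma variance_median_dev m :
  'V_P[D m]%E = ((4 * (2 * m + 3)%:R)^-1)%:E.
Proof.
rewrite varianceE// expectation_median_dev// -[(D m ^+ 2)%R]/(fun w => D m w ^+ 2).
by rewrite expectation_median_dev2// expe2 mule0 sube0.
Qed.

Let variance_H_le m : fine 'V_P[H m] <=
  C ^+ 2 * (3 / (16 * (2 * m + 3)%:R * (2 * m + 5)%:R)).
Proof.
rewrite -lee_fin fineK ?variance_fin_num// varianceE//.
apply: (@le_trans _ _ ('E_P[(H m ^+ 2)%R])%E).
  rewrite leeBlDr ?fin_numX// ?expectation_fin_num//.
    by rewrite leeDl// sqre_ge0.
  by apply: Lfun_subset12 => //; exact: fin_num_measure.
rewrite EFinM -(expectation_median_dev4 hU hU01).
rewrite unlock -ge0_integralZl//; last 3 first.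
- by apply/measurable_EFinP/measurable_funX; exact: measurable_median_dev.
- by move=> w _; rewrite lee_fin exprn_even_ge0.
- by rewrite lee_fin sqr_ge0.
apply: ge0_le_integral => //.
- by move=> w _; rewrite lee_fin sqr_ge0.
- by apply/measurable_EFinP; exact: (measurable_funX 2 (measurable_H m)).
- exact: (measurable_int _ (integrable_CD4 m)).
- by move=> w _; rewrite -EFinM lee_fin sqr_H_le.
Qed.

Let F_median m : (fun w => F (median_rv U m w)) =
  (cst (F 2^-1) \+ (fun w => a * D m w + H m w))%R.
Proof. by apply/funext => w; rewrite /= /H; ring. Qed.

Let aDH_Lfun2 m : (fun w => a * D m w + H m w) \in Lfun P 2%:E.
Proof.
have -> : (fun w => a * D m w + H m w) = (a \o* D m \+ H m)%R.
  by apply/funext => w /=; rewrite mulrC.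
have aD : a \o* D m \in Lfun P 2%:E by rewrite Lfun_scale// ler1n.
by rewrite rpredD// lee1n.
Qed.

Lemma F_median_Lfun2 m : (fun w => F (median_rv U m w)) \in Lfun P 2%:E.
Proof.
have c2 : cst (F 2^-1) \in Lfun P 2%:E by exact: Lfun_cst.
by rewrite F_median rpredD// lee1n.
Qed.

Lemma variance_F_median eta m : 0 < eta ->
  `|fine 'V_P[(fun w => F (median_rv U m w))%R] - a ^+ 2 / (4 * (2 * m).+1%:R)| <=
  `|a| * eta / (2 * m).+1%:R +
  (`|a| * C ^+ 2 / eta + C ^+ 2 + a ^+ 2) / (2 * m).+1%:R ^+ 2.
Proof.
move=> eta0; rewrite F_median varianceD_cst_l//.
have := variance_perturbation a (D_Lfun2 m) (H_Lfun2 m) eta0.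
have := fine_ge0 (variance_ge0 P (H m)); have := variance_H_le m.
rewrite variance_median_dev [fine (_%:E)]/=.
rewrite (_ : 2 * m + 3 = (2 * m).+1 + 2)%N; last by lia.
rewrite (_ : 2 * m + 5 = (2 * m).+1 + 4)%N; last by lia.
rewrite !natrD => yle y0 vle.
by apply: perturbation_rate yle vle; rewrite ?ltr0n.
Qed.

End MedianFunctionVariance.

(** * The asymptotic variance *)

Theorem theorem2 (R : realType) (d dX dE : measure_display)
    (Omega : measurableType d) (P : probability Omega R)
    (Xs : measurableType dX) (E : measurableType dE)
    (n : nat) (D : n.-tuple (Xs * bool))
    (X : {RV P >-> Xs}) (Y : {RV P >-> bool})
    (hY : forall l' : bool, (0 < P (Y @^-1` [set l']))%E)
    (g : Xs -> n.-tuple (Xs * bool) -> E -> bool)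
    (hg : measurable_fun setT (fun p : Xs * E => g p.1 D p.2))
    (xi : nat -> {RV P >-> E})
    (hxi : iid xi)
    (hXYxi : independent_sigma P
       (g_sigma_algebra_preimage (fun w => (X w, Y w))) (sigma_seq xi))
    (Q : nat -> Omega -> Xs -> bool)
    (hQ : forall i w x, Q i w x = g x D (xi i w))
    (f : bool -> R -> R)
    (hf : forall l' : bool,
       density01 (pushforward (cond_law X Y l') (theta P Q)) (f l') /\
       lipschitz_near_half (f l'))
    (U : nat -> {RV P >-> (measurableTypeR R)})
    (hU : iid U)
    (hU01 : forall A : set (measurableTypeR R), measurable A ->
       distribution P (U 0%N) A = uniform_prob (@ltr01 R) A)
    (hXYU : independent_sigma P
       (g_sigma_algebra_preimage (fun w => (X w, Y w))) (sigma_seq U))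
    (l : bool) :
  forall t : nat,
    fine 'V_P[Err (theta P Q) U (cond_law X Y l) t l] =
    1 / (4 * t%:R) * f l 2^-1 ^+ 2
      +o_(t \near within [set t | odd t] \oo) (1 / t%:R : R).
Proof.
have [dq lipq] := hf l.
have mth : measurable_fun setT (theta P Q).
  exact: (@measurable_theta _ _ _ _ _ P _ _ (xi 0%N)
    (fun x e => g x D e) Q hg (hQ 0%N)).
pose mu : probability Xs R :=
  distribution (mnormalize (mrestr P (measurable_label Y l)) P) X.
have dmu : density01 (pushforward mu (theta P Q)) (f l) by exact: dq.
have q_ge0 : forall s, 0 <= s <= 1 -> 0 <= f l s by case: dq.
have iq := integrable_density dmu.
have [C approxF] := primitive_quadratic_approx q_ge0 iq lipq.
have mF : measurable_fun setT (primitive (f l)).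
  by apply: nondecreasing_measurable => //; exact: primitive_nondecreasing.
set a := f l 2^-1 in approxF *.
pose V t := fine 'V_P[Err (theta P Q) U (cond_law X Y l) t l].
have V_median m : V (2 * m).+1 =
    fine 'V_P[(fun w => primitive (f l) (median_rv U m w))%R].
  pose FM w := primitive (f l) (median_rv U m w).
  have FM2 : FM \in Lfun P 2%:E.
    exact: (F_median_Lfun2 hU hU01 mF approxF m).
  have ErrE : Err (theta P Q) U (cond_law X Y l) (2 * m).+1 l =
      if l then FM else (cst 1 \- FM)%R.
    apply/funext => w; rewrite [LHS](Err_primitive U mth dmu).
    by case: ifP.
  rewrite -[RHS]/(fine 'V_P[FM])%E /V ErrE; move: FM FM2 {ErrE} => FM FM2.
  by case: (l) => //; rewrite varianceB_cst_l.
pose g' (t : nat) : R := 1 / (4 * t%:R) * a ^+ 2.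
pose Fodd := within_filter_on [set t | odd t] eventually_filterType.
suff Vlim : forall eps : R, 0 < eps ->
    \forall t \near Fodd, `|V t - g' t| <= eps * `|1 / t%:R|.
  have VE := (@eqaddoP R nat R R Fodd V g' (fun t => 1 / t%:R)).2 Vlim.
  by move=> t; exact: (congr1 (fun h => h t) VE).
move=> eps eps0.
(* A property holds eventually within a set when, by definition, membership
   eventually implies it. *)
suff : \forall t \near \oo, odd t -> `|V t - g' t| <= eps * `|1 / t%:R| by [].
(* eta makes the part of order 1/t at most eps/(2t); the rest is K/t^2, which is
   at most eps/(2t) once t >= 2K/eps. *)
pose eta := eps / (2 * (`|a| + 1)).
have eta0 : 0 < eta by rewrite divr_gt0// mulr_gt0// ltr_wpDl.
pose K := `|a| * C ^+ 2 / eta + C ^+ 2 + a ^+ 2.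
have [N KN] : exists N : nat, 2 * K / eps <= N%:R.
  exists (Num.bound `|2 * K / eps|).
  by rewrite (le_trans (ler_norm _))// ltW// archi_boundP.
exists N.+1 => // t /= Nt todd.
have tE : t = (2 * t./2).+1 by rewrite -[LHS]odd_double_half todd -muln2 mulnC.
have t0 : 0 < t%:R :> R by rewrite ltr0n; case: (t) Nt.
have := variance_F_median hU hU01 mF approxF t./2 eta0.
rewrite -V_median -tE -/K.
have <- : g' t = a ^+ 2 / (4 * t%:R) by rewrite /g' mul1r mulrC.
move=> /le_trans; apply.
rewrite mul1r [`|t%:R^-1|]ger0_norm ?invr_ge0 ?(ltW t0)//.
have aeta : `|a| * eta <= eps / 2.
  rewrite /eta mulrA ler_pdivrMr ?mulr_gt0 ?ltr_wpDl//.
  have := normr_ge0 a; nra.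
have Kt : K / t%:R <= eps / 2.
  rewrite ler_pdivrMr//.
  have : N%:R <= t%:R :> R by rewrite ler_nat ltnW.
  move: KN; rewrite ler_pdivrMr//; nra.
clearbody K eta; rewrite (_ : _ + _ = (`|a| * eta + K / t%:R) / t%:R).
  by rewrite ler_pM2r ?invr_gt0//; lra.
by field; rewrite gt_eqF.
Qed.
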